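(* Let $(A,\triangleright,\triangleleft)$ be a braided group, let $\mathcal P$ be a group with center $Z(\mathcal P)$, and let $\psi:A\times A\to Z(\mathcal P)$ be a map such that for all $a,b,c\in A$ $$\psi(a,bc)=\psi(a,b)\,\psi(a\triangleleft b,c),\qquad \psi(ab,c)=\psi(a,b\triangleright c)\,\psi(b,c).$$ Let $D$ be the group with underlying set $A\times\mathcal P\times A$ and multiplication $$(a,P,c)(x,Q,z)=\bigl(a(c\triangleright x),\,P\psi(c,x)Q,\,(c\triangleleft x)z\bigr).$$ Let $V=A\times\{1\}\times\{1\}$, $H=\{1\}\times\{1\}\times A$, $\gamma:\mathcal P\to D$, $\gamma_P=(1,P,1)$, and $\phi:H\to V$, $\phi(1,1,a)=(a,1,1)$. Then $(D,V,H,\gamma,\phi)$ is a braided groupoid datum.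
   Context: Groupoids: $\mathfrak s,\mathfrak e$ denote source and target; $g,h$ are composable if $\mathfrak e(g)=\mathfrak s(h)$, and the composite is written $gh$. $\mathcal G(P,Q)$ is the set of arrows with source $P$ and target $Q$, and $\mathcal G(P)=\mathcal G(P,P)$. A subgroupoid is wide if it has the same set of objects. A left action of a groupoid $\mathcal G\rightrightarrows\mathcal P$ on $(\mathcal E,p:\mathcal E\to\mathcal P)$ is a map $(g,x)\mapsto g\rightharpoonup x$ defined when $\mathfrak e(g)=p(x)$ with $p(g\rightharpoonup x)=\mathfrak s(g)$, $g\rightharpoonup(h\rightharpoonup x)=gh\rightharpoonup x$, $\mathrm{id}_{p(x)}\rightharpoonup x=x$. A right action is a map $(x,g)\mapsto x\leftharpoonup g$ defined when $p(x)=\mathfrak s(g)$ with $p(x\leftharpoonup g)=\mathfrak e(g)$, $(x\leftharpoonup g)\leftharpoonup h=x\leftharpoonup gh$, $x\leftharpoonup\mathrm{id}_{p(x)}=x$. A matched pair of groupoids $(\mathcal V,\mathcal H,\rightharpoonup,\leftharpoonup)$ consists of groupoids over the same base, a left action $\rightharpoonup$ of $\mathcal H$ on $(\mathcal V,\mathfrak s)$ and a right action $\leftharpoonup$ of $\mathcal V$ on $(\mathcal H,\mathfrak e)$ such that $\mathfrak e(x\rightharpoonup g)=\mathfrak s(x\leftharpoonup g)$, $x\rightharpoonup gh=(x\rightharpoonup g)((x\leftharpoonup g)\rightharpoonup h)$, $xy\leftharpoonup g=(x\leftharpoonup(y\rightharpoonup g))(y\leftharpoonup g)$ whenever defined. A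 braided groupoid $(\mathcal V,\rightharpoonup,\leftharpoonup)$ is a groupoid such that $(\mathcal V,\mathcal V,\rightharpoonup,\leftharpoonup)$ is a matched pair and $fg=(f\rightharpoonup g)(f\leftharpoonup g)$ for all composable $f,g$. A braided group is a braided groupoid with one object; i.e. $(A,\triangleright,\triangleleft)$ with $\triangleright$ a left action and $\triangleleft$ a right action of $A$ on the set $A$ satisfying $x\triangleright gh=(x\triangleright g)((x\triangleleft g)\triangleright h)$, $xy\triangleleft g=(x\triangleleft(y\triangleright g))(y\triangleleft g)$ and $xg=(x\triangleright g)(x\triangleleft g)$. Braided groupoid datum: let $D$ be a group, $V,H$ subgroups, $\gamma:\mathcal P\to D$ a map from a set with base point $O$ (here $O=1\in\mathcal P$), $\gamma_O=1$, such that $D=\coprod_{P\in\mathcal P}V\gamma_PH$ and $V\cap zHz^{-1}=\{1\}$ for all $z\in D$, and $\phi:H\to V$ a group isomorphism. Let $\mathcal D\rightrightarrows\mathcal P$ be a connected groupoid with $\mathcal D(O)=D$ and choose $\tau_P\in\mathcal D(O,P)$, $\tau_O=1$. Define wide subgroupoids $\mathcal V(P,Q)=\tau_P^{-1}V\tau_Q$ and $\mathcal H(P,Q)=\tau_P^{-1}\gamma_PH\gamma_Q^{-1}\tau_Q$. Every arrow of $\mathcal D$ is uniquely a product of an arrow of $\mathcal V$ followed by an arrow of $\mathcal H$; for composable $x\in\mathcal H$, $g\in\mathcal V$ write $xg=(x\rightharpoonup g)(x\leftharpoonup g)$ with $x\rightharpoonup g\in\mathcal V$, $x\leftharpoonup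 g\in\mathcal H$; this is a matched pair. Let $\phi:\mathcal H\to\mathcal V$, $\phi(\tau_P^{-1}\gamma_Px\gamma_Q^{-1}\tau_Q)=\tau_P^{-1}\phi(x)\tau_Q$, and for composable $g,h\in\mathcal V$ put $g\rightharpoonup h:=\phi^{-1}(g)\rightharpoonup h$, $g\leftharpoonup h:=\phi(\phi^{-1}(g)\leftharpoonup h)$. The collection $(D,V,H,\gamma,\phi)$ is a braided groupoid datum if $(\mathcal V,\rightharpoonup,\leftharpoonup)$ is a braided groupoid. *)

(* Defs.v *)
From HB Require Import structures.
From mathcomp Require Import all_boot.
From mathcomp Require Import boolp classical_sets functions.

Set Implicit Arguments.
Unset Strict Implicit.
Unset Printing Implicit Defensive.

Local Open Scope classical_set_scope.
Local Open Scope group_scope.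

(* Composition is a total function on arrows, constrained (and meaningful)
   only on composable pairs; [gcomp g h] is the diagrammatic composite gh,
   defined when [tgt g = src h].  The same convention applies to actions. *)
Record groupoid (P : Type) := Groupoid {
  arrow :> choiceType;
  src : arrow -> P;
  tgt : arrow -> P;
  gid : P -> arrow;
  gcomp : arrow -> arrow -> arrow;
  ginv : arrow -> arrow;
  src_id : forall p, src (gid p) = p;
  tgt_id : forall p, tgt (gid p) = p;
  src_comp : forall g h, tgt g = src h -> src (gcomp g h) = src g;
  tgt_comp : forall g h, tgt g = src h -> tgt (gcomp g h) = tgt h;
  gcompA : forall g h k, tgt g = src h -> tgt h = src k ->
    gcomp g (gcomp h k) = gcomp (gcomp g h) k;
  gcomp1g : forall g, gcomp (gid (src g)) g = g;
  gcompg1 : forall g, gcomp g (gid (tgt g)) = g;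
  src_inv : forall g, src (ginv g) = tgt g;
  tgt_inv : forall g, tgt (ginv g) = src g;
  gcompgV : forall g, gcomp g (ginv g) = gid (src g);
  gcompVg : forall g, gcomp (ginv g) g = gid (tgt g)
}.

Notation "g ** h" := (gcomp g h) (at level 40, left associativity).

Definition gconnected (P : Type) (G : groupoid P) : Prop :=
  forall p q, exists g : G, src g = p /\ tgt g = q.

Record wide_subgroupoid (P : Type) (G : groupoid P) := WideSubgroupoid {
  subgpd_set :> set G;
  subgpd_id : forall p, subgpd_set (gid G p);
  subgpd_comp : forall g h, subgpd_set g -> subgpd_set h ->
    tgt g = src h -> subgpd_set (g ** h);
  subgpd_inv : forall g, subgpd_set g -> subgpd_set (ginv g)
}.

Section SubGroupoid.
Variables (P : Type) (G : groupoid P) (S : wide_subgroupoid G).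

Definition sub_id (p : P) : S := exist (fun f => f \in (S : set G)) _ (mem_set (subgpd_id S p)).

(* The default value of [insubd] only matters for non-composable pairs. *)
Definition sub_comp (g h : S) : S := insubd g (val g ** val h).

Definition sub_inv (g : S) : S :=
  exist (fun f => f \in (S : set G)) _
    (mem_set (subgpd_inv (set_mem (valP g)))).

Lemma val_sub_comp (g h : S) : tgt (val g) = src (val h) ->
  val (sub_comp g h) = val g ** val h.
Proof.
move=> gh; rewrite /sub_comp insubdK //.
by apply/mem_set/subgpd_comp => //; apply/set_mem/valP.
Qed.

Definition sub_groupoid : groupoid P.
Proof.
refine (@Groupoid P {x : G | x \in (S : set G)} (fun g => src (val g))
  (fun g => tgt (val g)) sub_id sub_comp sub_inv _ _ _ _ _ _ _ _ _ _ _).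
- by move=> p; exact: src_id.
- by move=> p; exact: tgt_id.
- by move=> g h gh; rewrite val_sub_comp// src_comp.
- by move=> g h gh; rewrite val_sub_comp// tgt_comp.
- move=> g h k gh hk; apply: val_inj.
  by rewrite !val_sub_comp ?src_comp ?tgt_comp ?gcompA.
- by move=> g; apply: val_inj; rewrite val_sub_comp ?tgt_id// gcomp1g.
- by move=> g; apply: val_inj; rewrite val_sub_comp ?src_id// gcompg1.
- by move=> g; exact: src_inv.
- by move=> g; exact: tgt_inv.
- by move=> g; apply: val_inj; rewrite val_sub_comp ?src_inv//= gcompgV.
- by move=> g; apply: val_inj; rewrite val_sub_comp ?tgt_inv//= gcompVg.
Defined.

End SubGroupoid.

Record left_action (P : Type) (G : groupoid P) (E : Type) (p : E -> P)
    (act : G -> E -> E) : Prop := LeftAction {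
  lact_proj : forall g x, tgt g = p x -> p (act g x) = src g;
  lact_comp : forall g h x, tgt g = src h -> tgt h = p x ->
    act g (act h x) = act (g ** h) x;
  lact_id : forall x, act (gid G (p x)) x = x
}.

Record right_action (P : Type) (G : groupoid P) (E : Type) (p : E -> P)
    (act : E -> G -> E) : Prop := RightAction {
  ract_proj : forall x g, p x = src g -> p (act x g) = tgt g;
  ract_comp : forall x g h, p x = src g -> tgt g = src h ->
    act (act x g) h = act x (g ** h);
  ract_id : forall x, act x (gid G (p x)) = x
}.

Record matched_pair (P : Type) (V H : groupoid P)
    (lact : H -> V -> V) (ract : H -> V -> H) : Prop := MatchedPair {
  mp_left : left_action (@src P V) lact;
  mp_right : right_action (@tgt P H) ract;
  mp_tgt_src : forall (x : H) (g : V), tgt x = src g ->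
    tgt (lact x g) = src (ract x g);
  mp_lact_comp : forall (x : H) (g h : V), tgt x = src g -> tgt g = src h ->
    lact x (g ** h) = lact x g ** lact (ract x g) h;
  mp_ract_comp : forall (x y : H) (g : V), tgt x = src y -> tgt y = src g ->
    ract (x ** y) g = ract x (lact y g) ** ract y g
}.

Record braided_groupoid (P : Type) (V : groupoid P) (lact ract : V -> V -> V)
    : Prop := BraidedGroupoid {
  bg_matched : matched_pair lact ract;
  bg_braided : forall f g : V, tgt f = src g -> f ** g = lact f g ** ract f g
}.

Record braided_group (A : groupType) (lact ract : A -> A -> A)
    : Prop := BraidedGroup {
  bgr_lactM : forall x y z, lact x (lact y z) = lact (x * y) z;
  bgr_lact1 : forall x, lact 1 x = x;
  bgr_ractM : forall x y z, ract (ract x y) z = ract x (y * z);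
  bgr_ract1 : forall x, ract x 1 = x;
  bgr_lact_mul : forall x g h, lact x (g * h) = lact x g * lact (ract x g) h;
  bgr_ract_mul : forall x y g, ract (x * y) g = ract x (lact y g) * ract y g;
  bgr_braided : forall x g, x * g = lact x g * ract x g
}.

(* A connected groupoid over [P] whose vertex group at [O] is identified with
   [D] through [iota], together with arrows [tau p] from [O] to [p]. *)
Record realization (D : groupType) (P : Type) (O : P) := Realization {
  real_groupoid :> groupoid P;
  real_connected : gconnected real_groupoid;
  iota : D -> real_groupoid;
  iota_bij : set_bij [set: D]
    [set f : real_groupoid | src f = O /\ tgt f = O] iota;
  iotaM : forall x y, iota (x * y) = iota x ** iota y;
  tau : P -> real_groupoid;
  src_tau : forall p, src (tau p) = O;
  tgt_tau : forall p, tgt (tau p) = p;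
  tau_base : tau O = gid real_groupoid O
}.

Section Datum.
Variables (D : groupType) (V H : groupClosed D) (P : Type) (O : P).
Variables (gamma : P -> D) (phi : D -> D).

Section Realized.
Variable G : realization D O.
Implicit Types (p q : P) (d : D).

(* tau_p^-1 d tau_q *)
Definition transport p q d : G := ginv (tau G p) ** iota G d ** tau G q.

Lemma src_iota d : src (iota G d) = O.
Proof. by case: (@iota_bij _ _ _ G) => + _ _ => /(_ d I)[]. Qed.

Lemma tgt_iota d : tgt (iota G d) = O.
Proof. by case: (@iota_bij _ _ _ G) => + _ _ => /(_ d I)[]. Qed.

Lemma src_transport p q d : src (transport p q d) = p.
Proof.
rewrite /transport !src_comp ?src_inv ?tgt_tau//;
  by rewrite ?tgt_comp ?tgt_inv ?src_tau ?src_iota ?tgt_iota.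
Qed.

Lemma tgt_transport p q d : tgt (transport p q d) = q.
Proof.
rewrite /transport !tgt_comp ?tgt_tau//;
  by rewrite ?tgt_comp ?tgt_inv ?src_tau ?src_iota ?tgt_iota.
Qed.

Lemma iota1 : iota G 1 = gid G O.
Proof.
have e := iotaM G 1 1; rewrite mulg1 in e.
have := congr1 (gcomp (ginv (iota G 1))) e.
rewrite gcompA ?tgt_inv ?tgt_iota ?src_iota// gcompVg tgt_iota.
by have := gcomp1g (iota G 1); rewrite src_iota => -> ->.
Qed.

Lemma transport1 p : transport p p 1 = gid G p.
Proof.
rewrite /transport iota1; have := gcompg1 (ginv (tau G p)).
by rewrite tgt_inv src_tau => ->; rewrite gcompVg tgt_tau.
Qed.

Lemma transportM p q r d e :
  transport p q d ** transport q r e = transport p r (d * e).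
Proof.
have sI := src_iota; have tI := tgt_iota.
rewrite {2}/transport -gcompA ?tgt_inv ?src_tau ?tgt_comp ?sI ?tI ?tgt_inv//.
rewrite gcompA ?tgt_transport ?src_inv ?src_comp ?tgt_inv ?src_tau ?tgt_tau
  ?sI ?tI//.
rewrite {1}/transport -[X in X ** _]gcompA ?src_inv ?tgt_tau ?tgt_comp ?tgt_inv ?src_tau ?sI ?tI//.
rewrite gcompgV src_tau -[X in gid _ X](tI d).
rewrite -[X in X ** _]gcompA ?tgt_inv ?src_tau ?sI ?src_id// gcompg1.
rewrite gcompA ?tgt_comp ?tgt_inv ?src_tau ?sI ?tI//.
by rewrite -[X in X ** _]gcompA ?tgt_inv ?src_tau ?sI ?tI// -iotaM.
Qed.

Lemma ginv_uniq (f g : G) :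
  tgt f = src g -> f ** g = gid G (src f) -> ginv f = g.
Proof.
move=> fg e; have tg : tgt g = src f by rewrite -(tgt_comp fg) e tgt_id.
rewrite -[LHS]gcompg1 tgt_inv -e gcompA ?tgt_inv// gcompVg fg.
by rewrite gcomp1g.
Qed.

Lemma transportV p q d : ginv (transport p q d) = transport q p d^-1.
Proof.
apply: ginv_uniq; rewrite ?src_transport ?tgt_transport//.
by rewrite transportM mulgV transport1.
Qed.

(* V(p, q) = tau_p^-1 V tau_q *)
Definition Vset : set G :=
  [set f | exists2 v, v \in V & f = transport (src f) (tgt f) v].

(* H(p, q) = tau_p^-1 gamma_p H gamma_q^-1 tau_q *)
Definition Hset : set G :=
  [set f | exists2 h, h \in H &
    f = transport (src f) (tgt f) (gamma (src f) * h * (gamma (tgt f))^-1)].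

Definition Vsub : wide_subgroupoid G.
Proof.
refine (@WideSubgroupoid P G Vset _ _ _).
- by move=> p; exists 1; rewrite ?gpred1// src_id tgt_id transport1.
- move=> f g [v Vv ef] [w Vw eg] fg; exists (v * w); first exact: gpredM.
  by rewrite src_comp// tgt_comp// {1}ef {1}eg -fg transportM.
- move=> f [v Vv ef]; exists v^-1; first by rewrite gpredV.
  by rewrite src_inv tgt_inv {1}ef transportV.
Defined.

Definition Hsub : wide_subgroupoid G.
Proof.
refine (@WideSubgroupoid P G Hset _ _ _).
- move=> p; exists 1; first exact: gpred1.
  by rewrite src_id tgt_id mulg1 mulgV transport1.
- move=> f g [v Vv ef] [w Vw eg] fg; exists (v * w); first exact: gpredM.
  by rewrite src_comp// tgt_comp// {1}ef {1}eg -fg transportM !mulgA mulgVK.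
- move=> f [v Vv ef]; exists v^-1; first by rewrite gpredV.
  by rewrite src_inv tgt_inv {1}ef transportV !invgM invgK mulgA.
Defined.

Definition Vgpd : groupoid P := sub_groupoid Vsub.
Definition Hgpd : groupoid P := sub_groupoid Hsub.

(* For composable x and g, the pair (x -> g, x <- g) such that
   xg = (x -> g)(x <- g) in the ambient groupoid. *)
Definition factorization (x : Hgpd) (g : Vgpd) : Vgpd * Hgpd :=
  xget (g, x) [set u : Vgpd * Hgpd |
    tgt u.1 = src u.2 /\ val x ** val g = val u.1 ** val u.2].

Definition HV_lact (x : Hgpd) (g : Vgpd) : Vgpd := (factorization x g).1.
Definition HV_ract (x : Hgpd) (g : Vgpd) : Hgpd := (factorization x g).2.

(* phi(tau_p^-1 gamma_p h gamma_q^-1 tau_q) = tau_p^-1 phi(h) tau_q *)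
Definition phi_arrow (x : Hgpd) : Vgpd :=
  xget (gid Vgpd (src x)) [set g : Vgpd | exists2 h, h \in H &
    val x = transport (src x) (tgt x)
              (gamma (src x) * h * (gamma (tgt x))^-1) /\
    val g = transport (src x) (tgt x) (phi h)].

Definition phi_arrow_inv (g : Vgpd) : Hgpd :=
  xget (gid Hgpd (src g)) [set x : Hgpd | phi_arrow x = g].

Definition V_lact (g h : Vgpd) : Vgpd := HV_lact (phi_arrow_inv g) h.
Definition V_ract (g h : Vgpd) : Vgpd := phi_arrow (HV_ract (phi_arrow_inv g) h).

End Realized.

(* [phi] is a total function on [D] of which only the restriction H -> V is
   used.  The property does not depend on the choice of a realization, and is
   required for every one (they exist by [realization_nonempty] below). *)
Record braided_groupoid_datum : Prop := BraidedGroupoidDatum {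
  dat_base : gamma O = 1;
  dat_cosets : forall d, exists! p,
    exists v h, [/\ v \in V, h \in H & d = v * gamma p * h];
  dat_inter : forall z,
    [set` V] `&` [set z * h * z^-1 | h in [set` H]] = [set 1];
  dat_phi_bij : set_bij [set` H] [set` V] phi;
  dat_phiM : {in H &, {morph phi : x y / x * y}};
  dat_braided : forall G : realization D O,
    braided_groupoid (@V_lact G) (@V_ract G)
}.

End Datum.

Definition pair_groupoid (D : groupType) (P : choiceType) : groupoid P.
Proof.
refine (@Groupoid P (P * D * P)%type (fun f => f.1.1) (fun f => f.2)
  (fun p => (p, 1, p)) (fun f g => (f.1.1, f.1.2 * g.1.2, g.2))
  (fun f => (f.2, f.1.2^-1, f.1.1)) _ _ _ _ _ _ _ _ _ _ _) => //=.
- by move=> f g h _ _; rewrite mulgA.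
- by move=> [[p d] q]; rewrite mul1g.
- by move=> [[p d] q]; rewrite mulg1.
- by move=> [[p d] q]; rewrite mulgV.
- by move=> [[p d] q]; rewrite mulVg.
Defined.

Lemma realization_nonempty (D : groupType) (P : choiceType) (O : P) :
  inhabited (realization D O).
Proof.
constructor.
refine (@Realization D P O (pair_groupoid D P) _ (fun d => (O, d, O)) _ _
  (fun p => (O, 1, p)) _ _ _) => //.
- by move=> p q; exists (p, 1, q).
- split=> [d _ //|d e _ _ [->] //|[[p d] q] [/= -> ->]].
  by exists d.
Qed.

Definition center (G : groupType) : set G := [set z | forall x, commute z x].
Arguments center G : clear implicits.

Definition extension (A P : groupType) (lact ract : A -> A -> A)
  (psi : A -> A -> P)
  of braided_group lact ract
   & (forall a b, center P (psi a b))
   & (forall a b c, psi a (b * c) = psi a b * psi (ract a b) c)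
   & (forall a b c, psi (a * b) c = psi a (lact b c) * psi b c) : Type :=
  (A * P * A)%type.

Section Extension.
Variables (A P : groupType) (lact ract : A -> A -> A) (psi : A -> A -> P).
Hypothesis hA : braided_group lact ract.
Hypothesis psiZ : forall a b, center P (psi a b).
Hypothesis psi_mulr : forall a b c,
  psi a (b * c) = psi a b * psi (ract a b) c.
Hypothesis psi_mull : forall a b c,
  psi (a * b) c = psi a (lact b c) * psi b c.

Local Notation D := (extension hA psiZ psi_mulr psi_mull).

HB.instance Definition _ := Choice.copy D (A * P * A)%type.

Definition ext_mul (d e : D) : D :=
  let: (a, p, c) := d in let: (x, q, z) := e in
  (a * lact c x, p * psi c x * q, ract c x * z).

Definition ext_one : D := (1, 1, 1).

Definition ext_inv (d : D) : D :=
  let: (a, p, c) := d in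
  (lact c^-1 a^-1, p^-1 * psi c^-1 a^-1, ract c^-1 a^-1).

Lemma lact1r x : lact x 1 = 1.
Proof.
have := bgr_lact_mul hA x 1 1; rewrite mulg1 (bgr_ract1 hA).
by rewrite -[LHS]mulg1 => /mulgI <-.
Qed.

Lemma ract1l x : ract 1 x = 1.
Proof.
have := bgr_ract_mul hA 1 1 x; rewrite mulg1 (bgr_lact1 hA).
by rewrite -[LHS]mulg1 => /mulgI <-.
Qed.

Lemma psi1r a : psi a 1 = 1.
Proof.
have := psi_mulr a 1 1; rewrite mulg1 (bgr_ract1 hA).
by rewrite -[LHS]mulg1 => /mulgI <-.
Qed.

Lemma psi1l a : psi 1 a = 1.
Proof.
have := psi_mull 1 1 a; rewrite mulg1 (bgr_lact1 hA).
by rewrite -[LHS]mulg1 => /mulgI <-.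
Qed.

Lemma ext_mulA : associative ext_mul.
Proof.
move=> [[a p] c] [[x q] z] [[u r] w] /=; congr (_, _, _).
- by rewrite (bgr_lact_mul hA) (bgr_lactM hA) mulgA.
- rewrite psi_mulr psi_mull !mulgA; congr (_ * _ * _).
  by rewrite -!mulgA (psiZ _ _ q) !mulgA.
- by rewrite (bgr_ract_mul hA) (bgr_ractM hA) mulgA.
Qed.

Lemma ext_mul1g : left_id ext_one ext_mul.
Proof.
move=> [[a p] c]; congr (_, _, _).
- by rewrite (bgr_lact1 hA) mul1g.
- by rewrite psi1l !mul1g.
- by rewrite ract1l mul1g.
Qed.

Lemma ext_mulg1 : right_id ext_one ext_mul.
Proof.
move=> [[a p] c]; congr (_, _, _).
- by rewrite lact1r mulg1.
- by rewrite psi1r !mulg1.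
- by rewrite (bgr_ract1 hA) mulg1.
Qed.

Lemma ext_mulVg : left_inverse ext_one ext_inv ext_mul.
Proof.
move=> [[a p] c]; congr (_, _, _).
- by rewrite -(bgr_lact_mul hA) mulVg lact1r.
- by rewrite -[p^-1 * _ * _]mulgA -psi_mulr mulVg psi1r mulg1 mulVg.
- by rewrite (bgr_ractM hA) mulVg (bgr_ract1 hA) mulVg.
Qed.

Lemma ext_mulgV : right_inverse ext_one ext_inv ext_mul.
Proof.
move=> [[a p] c]; congr (_, _, _).
- by rewrite (bgr_lactM hA) mulgV (bgr_lact1 hA) mulgV.
- rewrite mulgA -[p * _ * _]mulgA (psiZ _ _ p^-1) mulgA mulgV mul1g.
  by rewrite -psi_mull mulgV psi1l.
- by rewrite -(bgr_ract_mul hA) mulgV ract1l.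
Qed.

HB.instance Definition _ := isGroup.Build D
  ext_mulA ext_mul1g ext_mulg1 ext_mulVg ext_mulgV.

Lemma ext_mulE (d e : D) : d * e = ext_mul d e.
Proof. by []. Qed.

Lemma ext_invE (d : D) : d^-1 = ext_inv d.
Proof. by []. Qed.

(* A x {1} x {1} and {1} x {1} x A *)
Definition extV : {pred D} := fun d : D => (d.1.2 == 1) && (d.2 == 1).
Definition extH : {pred D} := fun d : D => (d.1.1 == 1) && (d.1.2 == 1).

Lemma extV_mul : mulg_closed extV.
Proof.
move=> [[a p] c] [[x q] z] /andP[/eqP/= -> /eqP/= ->] /andP[/eqP/= -> /eqP/= ->].
by rewrite ext_mulE unfold_in /= psi1l ract1l !mulg1 !eqxx.
Qed.

Lemma extV_1 : (1 : D) \in extV.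
Proof. by apply/andP; split. Qed.

Lemma extV_inv : invg_closed extV.
Proof.
move=> [[a p] c] /andP[/eqP/= -> /eqP/= ->].
by rewrite ext_invE unfold_in /= !invg1 psi1l ract1l ?mulg1 !eqxx.
Qed.

Lemma extH_mul : mulg_closed extH.
Proof.
move=> [[a p] c] [[x q] z] /andP[/eqP/= -> /eqP/= ->] /andP[/eqP/= -> /eqP/= ->].
by rewrite ext_mulE unfold_in /= psi1r lact1r ?mulg1 !eqxx.
Qed.

Lemma extH_1 : (1 : D) \in extH.
Proof. by apply/andP; split. Qed.

Lemma extH_inv : invg_closed extH.
Proof.
move=> [[a p] c] /andP[/eqP/= -> /eqP/= ->].
by rewrite ext_invE unfold_in /= !invg1 psi1r lact1r ?mulg1 !eqxx.
Qed.

HB.instance Definition _ := isMulClosed.Build D extV extV_mul.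
HB.instance Definition _ := isMul1Closed.Build D extV extV_1.
HB.instance Definition _ := isInvClosed.Build D extV extV_inv.
HB.instance Definition _ := isMulClosed.Build D extH extH_mul.
HB.instance Definition _ := isMul1Closed.Build D extH extH_1.
HB.instance Definition _ := isInvClosed.Build D extH extH_inv.

End Extension.

Arguments extV {A P lact ract psi} hA psiZ psi_mulr psi_mull.
Arguments extH {A P lact ract psi} hA psiZ psi_mulr psi_mull.

(* Main.v *)
(** Since [gamma_P H gamma_Q^-1 = {1} x {P Q^-1} x A], the arrows [P -> Q] of
    both subgroupoids are labelled by [A], and multiplying in [D] the labels of
    an [H]-arrow [c : P -> Q] and a [V]-arrow [a : Q -> R] gives
    [(c |> a, P Q^-1 psi(c, a), c <| a)].  Hence the exchanged factors are
    [c |> a : P -> S] and [c <| a : S -> R] with [S = P Q^-1 psi(c, a) R], and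
    on labels the braiding axioms are those of [A]; on the middle objects [S]
    they are the two cocycle identities for the central map [psi]. *)
Require Import Defs.
From HB Require Import structures.
From mathcomp Require Import all_boot.
From mathcomp Require Import boolp classical_sets functions.

Set Implicit Arguments.
Unset Strict Implicit.
Unset Printing Implicit Defensive.

Local Open Scope group_scope.

(** * Labels of arrows in a realization *)

Section Transport.
Variables (D : groupType) (P : Type) (O : P) (G : realization D O).

Lemma iota_inj : injective (Defs.iota G).
Proof.
have [_ inj _] := @iota_bij _ _ _ G.
by move=> d e; apply: inj; rewrite inE.
Qed.

Lemma iota_transport d : Defs.iota G d = transport G O O d.
Proof.
have idl (f : G) : src f = O -> gid G O ** f = f.
  by move=> e; rewrite -[X in gid _ X]e gcomp1g.
have idr (f : G) : tgt f = O -> f ** gid G O = f.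
  by move=> e; rewrite -[X in gid _ X]e gcompg1.
rewrite /transport tau_base (_ : ginv (gid G O) = gid G O); last first.
  by apply: ginv_uniq; rewrite ?src_id ?tgt_id// idl ?src_id.
by rewrite idl ?src_iota// idr ?tgt_iota.
Qed.

(** Composing on both sides with arrows of label 1 carries the arrow back to a loop at the base
    point, where [transport] is the injective map [iota] because [tau] is the identity there. *)
Lemma transport_inj p q : injective (transport G p q).
Proof.
move=> d e /(congr1 (fun f => transport G O p 1 ** f ** transport G q O 1)).
by rewrite !transportM !mul1g !mulg1 -!iota_transport => /iota_inj.
Qed.

End Transport.

(** * Coordinates in the extension group *)

Section ExtensionDatum.
Variables (A P : groupType) (lact ract : A -> A -> A).
Variables (hA : braided_group lact ract) (psi : A -> A -> P).
Variable psiZ : forall a b, center P (psi a b).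
Variable psi_mulr :
  forall a b c, psi a (b * c) = psi a b * psi (ract a b) c.
Variable psi_mull :
  forall a b c, psi (a * b) c = psi a (lact b c) * psi b c.

Let D : groupType := extension hA psiZ psi_mulr psi_mull.
Let V : groupClosed D := extV hA psiZ psi_mulr psi_mull.
Let H : groupClosed D := extH hA psiZ psi_mulr psi_mull.
Let gamma : P -> D := fun p => (1, p, 1).
Let phi : D -> D := fun d => (d.2, 1, 1).

Lemma mem_extV a : ((a, 1, 1) : D) \in V.
Proof. by rewrite unfold_in /= !eqxx. Qed.

Lemma mem_extH a : ((1, 1, a) : D) \in H.
Proof. by rewrite unfold_in /= !eqxx. Qed.

Lemma extVP (d : D) : reflect (exists a, d = (a, 1, 1)) (d \in V).
Proof.
apply: (iffP idP) => [|[a ->]]; last exact: mem_extV.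
by case: d => [[a p] c] /andP[/eqP/= -> /eqP/= ->]; exists a.
Qed.

Lemma extHP (d : D) : reflect (exists a, d = (1, 1, a)) (d \in H).
Proof.
apply: (iffP idP) => [|[a ->]]; last exact: mem_extH.
by case: d => [[a p] c] /andP[/eqP/= -> /eqP/= ->]; exists c.
Qed.

Lemma ext_mul_tripleE a p c x q z : ((a, p, c) : D) * ((x, q, z) : D) =
  (a * lact c x, p * psi c x * q, ract c x * z) :> D.
Proof. by []. Qed.

Lemma ext_mulVl a x q z :
  ((a, 1, 1) : D) * ((x, q, z) : D) = (a * x, q, z) :> D.
Proof.
rewrite ext_mul_tripleE (bgr_lact1 hA) (ract1l hA).
by rewrite (psi1l hA psi_mull) !mul1g.
Qed.

Lemma ext_mulHr a x q z :
  ((x, q, z) : D) * ((1, 1, a) : D) = (x, q, z * a) :> D.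
Proof.
rewrite ext_mul_tripleE (lact1r hA) (bgr_ract1 hA).
by rewrite (psi1r hA psi_mulr) !mulg1.
Qed.

Lemma gammaV p : (gamma p)^-1 = (1, p^-1, 1) :> D.
Proof.
rewrite ext_invE /ext_inv /= !invg1 (lact1r hA) (ract1l hA).
by rewrite (psi1l hA psi_mull) mulg1.
Qed.

Lemma gamma_conjH p c q :
  gamma p * ((1, 1, c) : D) * (gamma q)^-1 = (1, p * q^-1, c) :> D.
Proof.
rewrite ext_mulHr gammaV ext_mul_tripleE (lact1r hA) (bgr_ract1 hA).
by rewrite (psi1r hA psi_mulr) !mulg1 mul1g.
Qed.

(** * The matched pair and its braiding on labelled arrows *)

Section Realized.
Variable G : realization D (1 : P).

Let GV := Vgpd V G.
Let GH := Hgpd H gamma G.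

Lemma varr_subproof p a q :
  transport G p q ((a, 1, 1) : D) \in (@Vset D V P 1 G : set G).
Proof.
apply/mem_set; exists (a, 1, 1); first exact: mem_extV.
by rewrite src_transport tgt_transport.
Qed.

Lemma harr_subproof p c q :
  transport G p q ((1, p * q^-1, c) : D) \in (@Hset D H P 1 gamma G : set G).
Proof.
apply/mem_set; exists (1, 1, c); first exact: mem_extH.
by rewrite src_transport tgt_transport gamma_conjH.
Qed.

(** Normal forms: by [varrP] and [harrP] every arrow of either subgroupoid is of this kind, so the
    axioms reduce to identities between labels and objects. *)
Definition varr p a q : GV :=
  exist (fun f => f \in (Vsub V G : set G)) _ (varr_subproof p a q).
Definition harr p c q : GH :=
  exist (fun f => f \in (Hsub H gamma G : set G)) _ (harr_subproof p c q).

Lemma src_varr p a q : src (varr p a q) = p.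
Proof. exact: src_transport. Qed.

Lemma tgt_varr p a q : tgt (varr p a q) = q.
Proof. exact: tgt_transport. Qed.

Lemma src_harr p c q : src (harr p c q) = p.
Proof. exact: src_transport. Qed.

Lemma tgt_harr p c q : tgt (harr p c q) = q.
Proof. exact: tgt_transport. Qed.

Lemma varrP (g : GV) : exists a, g = varr (src g) a (tgt g).
Proof.
have /set_mem[v /extVP[a ->] e] := valP g.
by exists a; apply: val_inj.
Qed.

Lemma harrP (x : GH) : exists c, x = harr (src x) c (tgt x).
Proof.
have /set_mem[v /extHP[a ->]] := valP x; rewrite gamma_conjH => e.
by exists a; apply: val_inj.
Qed.

Lemma varr1 p : gid GV p = varr p 1 p.
Proof. by apply: val_inj; rewrite /= -transport1. Qed.

Lemma varrM p a q b r : varr p a q ** varr q b r = varr p (a * b) r.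
Proof.
apply: val_inj; rewrite val_sub_comp /= ?src_transport ?tgt_transport//.
by rewrite transportM ext_mulVl.
Qed.

(** The object [s] is the solution of s r^-1 = p q^-1 psi(c, a), the equation of middle coordinates.
    As the factorization exists and is unique, [xget] never returns its default. *)
Lemma factorization_arr p c q a r (s := p * q^-1 * psi c a * r) :
  factorization (harr p c q) (varr q a r) =
  (varr p (lact c a) s, harr s (ract c a) r).
Proof.
apply: xget_unique.
  rewrite /= !transportM src_transport tgt_transport ext_mulVl ext_mul_tripleE.
  by rewrite !mul1g !mulg1 /s mulgK.
move=> [g x].
(* Uniqueness: the outer endpoints agree, so [transport_inj] compares elements of [D]; the middle
   coordinate then determines the intermediate object. *)
have [b ->] := varrP g; move: (src g) (tgt g) => p' s'.
have [d ->] := harrP x; move: (src x) (tgt x) => s'' r'.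
rewrite /= src_transport tgt_transport => -[<-{s''}].
rewrite !transportM ext_mulVl ext_mul_tripleE !mul1g !mulg1 => e.
have ep : p' = p.
  by have := congr1 (@src _ G) e; rewrite !src_transport.
have er : r' = r.
  by have := congr1 (@tgt _ G) e; rewrite !tgt_transport.
rewrite ep er in e; case: (transport_inj e) => eb es ed.
by rewrite ep er eb ed (_ : s' = s)// /s es mulgVK.
Qed.

(** On labels [phi_arrow] is the identity of [A]; the choice behind it is forced since an arrow
    determines its label. *)
Lemma phi_harr p c q : phi_arrow V phi (harr p c q) = varr p c q.
Proof.
apply: xget_unique.
  exists (1, 1, c); first exact: mem_extH.
  by rewrite src_harr tgt_harr gamma_conjH.
move=> g [h /extHP[d ->]]; rewrite src_harr tgt_harr gamma_conjH /=.
by move=> [e eg]; apply: val_inj; case: (transport_inj e) => ->.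
Qed.

Lemma phi_inv_varr p c q : phi_arrow_inv H gamma phi (varr p c q) = harr p c q.
Proof.
apply: xget_unique; first exact: phi_harr.
move=> x /=; have [d ->] := harrP x; rewrite phi_harr => e.
have ep : src x = p by have := congr1 (@src _ GV) e; rewrite !src_varr.
have eq : tgt x = q by have := congr1 (@tgt _ GV) e; rewrite !tgt_varr.
by move: e; rewrite ep eq => /(congr1 val) e'; case: (transport_inj e') => ->.
Qed.

Lemma V_lact_varr p c q a r :
  V_lact H gamma phi (varr p c q) (varr q a r) =
  varr p (lact c a) (p * q^-1 * psi c a * r).
Proof. by rewrite /V_lact phi_inv_varr /HV_lact factorization_arr. Qed.

Lemma V_ract_varr p c q a r :
  V_ract H gamma phi (varr p c q) (varr q a r) =
  varr (p * q^-1 * psi c a * r) (ract c a) r.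
Proof. by rewrite /V_ract phi_inv_varr /HV_ract factorization_arr phi_harr. Qed.

Lemma extension_braided :
  braided_groupoid (@V_lact D V H P 1 gamma phi G)
    (@V_ract D V H P 1 gamma phi G).
Proof.
split; last first.
  move=> f g fg; have [a ->] := varrP f; have [b ->] := varrP g.
  (* The intermediate object disappears in the composite, leaving the braiding identity of [A]. *)
  by rewrite fg V_lact_varr V_ract_varr !varrM (bgr_braided hA).
split.
- split.
  + move=> f g fg; have [a ->] := varrP f; have [b ->] := varrP g.
    by rewrite fg V_lact_varr !src_varr.
  + move=> f g h fg gh.
    have [a ->] := varrP f; have [b ->] := varrP g; have [c ->] := varrP h.
    rewrite fg gh !V_lact_varr varrM V_lact_varr (bgr_lactM hA); congr varr.
    (* Equality of targets. With q = [src g], centrality moves psi(a, b |> c) past q, so that q^-1 q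
       cancels, and then past the inverse of [src h]. *)
    rewrite psi_mull !mulgA; congr (_ * _ * _).
    by rewrite -[_ * src g]mulgA psiZ mulgA mulgVK -mulgA psiZ mulgA.
  + move=> f; have [a ->] := varrP f.
    rewrite src_varr varr1 V_lact_varr (bgr_lact1 hA) (psi1l hA psi_mull).
    by rewrite mulgV !mul1g.
- split.
  + move=> f g fg; have [a ->] := varrP f; have [b ->] := varrP g.
    by rewrite fg V_ract_varr !tgt_varr.
  + move=> f g h fg gh.
    have [a ->] := varrP f; have [b ->] := varrP g; have [c ->] := varrP h.
    rewrite fg gh !V_ract_varr varrM V_ract_varr (bgr_ractM hA); congr varr.
    (* Equality of sources: the object between the two moves cancels, and psi(a, b) psi(a <| b, c) =
       psi(a, bc). *)
    by rewrite psi_mulr !mulgA mulgK.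
  + move=> f; have [a ->] := varrP f.
    rewrite tgt_varr varr1 V_ract_varr (bgr_ract1 hA) (psi1r hA psi_mulr).
    by rewrite mulg1 mulgVK.
- move=> f g fg; have [a ->] := varrP f; have [b ->] := varrP g.
  by rewrite fg V_lact_varr V_ract_varr src_varr tgt_varr.
- move=> f g h fg gh.
  have [a ->] := varrP f; have [b ->] := varrP g; have [c ->] := varrP h.
  rewrite fg gh varrM !V_lact_varr V_ract_varr V_lact_varr varrM.
  by rewrite (bgr_lact_mul hA) psi_mulr !mulgA mulgK.
- move=> f g h fg gh.
  have [a ->] := varrP f; have [b ->] := varrP g; have [c ->] := varrP h.
  rewrite fg gh varrM !V_ract_varr V_lact_varr V_ract_varr varrM.
  rewrite (bgr_ract_mul hA) psi_mull; congr varr.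
  (* The sources satisfy the same equation as the targets in the left action law, again by
     centrality. *)
  rewrite !mulgA; congr (_ * _ * _).
  by rewrite -[_ * src g]mulgA psiZ mulgA mulgVK -mulgA psiZ mulgA.
Qed.

End Realized.

(** * Double cosets, trivial intersections and the isomorphism *)

Lemma ext_cosets (d : D) : exists! p,
  exists v h, [/\ v \in V, h \in H & d = v * gamma p * h].
Proof.
(* Since (a, 1, 1)(1, p, 1)(1, 1, c) = (a, p, c), the middle coordinate indexes the double coset. *)
case: d => [[a p] c]; exists p; split.
  exists (a, 1, 1), (1, 1, c); split; rewrite ?mem_extV ?mem_extH//.
  by rewrite ext_mulVl ext_mulHr /= mulg1 mul1g.
move=> q [v [h [/extVP[x ->] /extHP[z ->]]]].
by rewrite ext_mulVl ext_mulHr => -[].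
Qed.

(** In the form z h = v z this is read off the first coordinate: right multiplication by [H] fixes
    it, while left multiplication by v = (x, 1, 1) multiplies it by x. *)
Lemma ext_conj_trivial (z v h : D) :
  v \in V -> h \in H -> z * h * z^-1 = v -> v = 1.
Proof.
case: z => [[a p] c] /extVP[x ->] /extHP[d ->] e.
have : ((a, p, c) : D) * ((1, 1, d) : D) = ((x, 1, 1) : D) * (a, p, c)
  by rewrite -e mulgVK.
rewrite ext_mulVl ext_mulHr => -[ax _].
by have -> : x = 1 by apply: (mulIg a); rewrite mul1g.
Qed.

Lemma ext_phi_bij : set_bij [set` H] [set` V] phi.
Proof.
split.
- by move=> _ /= /extHP[a ->]; exact: mem_extV.
- by move=> _ _ /set_mem/extHP[a ->] /set_mem/extHP[b ->] [->].
- by move=> _ /= /extVP[a ->]; exists (1, 1, a); first exact: mem_extH.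
Qed.

Lemma ext_phiM : {in H &, {morph phi : x y / x * y}}.
Proof.
by move=> _ _ /extHP[a ->] /extHP[b ->]; rewrite ext_mulHr /phi ext_mulVl.
Qed.

End ExtensionDatum.

Theorem lemma2p6 (A P : groupType) (lact ract : A -> A -> A)
  (hA : braided_group lact ract) (psi : A -> A -> P)
  (psiZ : forall a b, center P (psi a b))
  (psi_mulr : forall a b c, psi a (b * c) = psi a b * psi (ract a b) c)
  (psi_mull : forall a b c, psi (a * b) c = psi a (lact b c) * psi b c) :
  let D : groupType := extension hA psiZ psi_mulr psi_mull in
  let V : groupClosed D := extV hA psiZ psi_mulr psi_mull in
  let H : groupClosed D := extH hA psiZ psi_mulr psi_mull in
  let gamma : P -> D := fun p => (1, p, 1) in
  let phi : D -> D := fun d => (d.2, 1, 1) in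
  braided_groupoid_datum V H 1 gamma phi.
Proof.
move=> D V H gamma phi; split.
- by [].
- exact: ext_cosets.
- move=> z; apply/seteqP; split=> v /=.
    by move=> [Vv [h Hh]]; exact: ext_conj_trivial.
  move=> ->; split; first exact: gpred1.
  by exists 1; [exact: gpred1|rewrite mulg1 mulgV].
- exact: ext_phi_bij.
- exact: ext_phiM.
- exact: extension_braided.
Qed.
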